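(* For all integers $r\ge 2$, $d\ge 1$ and $s\ge 2$, one has $\gamma_{s}(r,d)=\infty$.
   Context: A set in $\mathbb{R}^{d}$ is called $s$-convex if it is a union of at most $s$ convex sets. Let $\gamma_{s}(r,d)$ be the least integer $t$ with the following property: for every collection of pairwise disjoint finite sets $Y_{0},\ldots,Y_{d}\subseteq\mathbb{R}^{d}$ with $|Y_{j}|\ge t$ for every $j\in\{0,\ldots,d\}$, there are pairwise disjoint rainbow sets $R_{1},\ldots,R_{r}$ such that for every choice of $s$-convex sets $C_{i}\supseteq R_{i}$, $i\in[r]=\{1,\ldots,r\}$, one has $\bigcap_{i=1}^{r}C_{i}\ne\emptyset$. Here $R_{1},\ldots,R_{r}$ being rainbow sets means that each $R_{i}$ consists of exactly one point from each class, i.e. $R_{i}\subseteq Y_{0}\cup\cdots\cup Y_{d}$ and $|R_{i}\cap Y_{j}|=1$ for every $i\in[r]$ and $j\in\{0,\ldots,d\}$. If no such $t$ exists, set $\gamma_{s}(r,d)=\infty$. *)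

(* Defs.v *)
From mathcomp Require Import all_boot all_order all_algebra.
From mathcomp Require Import finmap.
From mathcomp Require Import boolp classical_sets reals convex.

Set Implicit Arguments.
Unset Strict Implicit.
Unset Printing Implicit Defensive.

Local Open Scope fset_scope.
Local Open Scope classical_set_scope.

Definition s_convex (R : realType) (d s : nat) (A : set 'rV[R]_d) : Prop :=
  exists (n : nat) (K : 'I_n -> set 'rV[R]_d),
    [/\ n <= s, forall k, convex_set (K k) & A = \bigcup_k K k].

Definition pairwise_disjoint (T : choiceType) (n : nat)
    (F : 'I_n -> {fset T}) : Prop :=
  forall i j, i != j -> [disjoint F i & F j]%fset.

Definition rainbow (T : choiceType) (n : nat) (Y : 'I_n -> {fset T})
    (A : {fset T}) : Prop :=
  [set` A] `<=` \bigcup_j [set` Y j] /\ forall j, #|` A `&` Y j |%fset = 1.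

Definition rainbow_intersection_property (R : realType) (s r d t : nat) : Prop :=
  forall Y : 'I_d.+1 -> {fset 'rV[R]_d},
    pairwise_disjoint Y ->
    (forall j, t <= #|` Y j |) ->
    exists P : 'I_r -> {fset 'rV[R]_d},
      [/\ pairwise_disjoint P,
          forall i, rainbow Y (P i) &
          forall C : 'I_r -> set 'rV[R]_d,
            (forall i, s_convex s (C i)) ->
            (forall i, [set` P i] `<=` C i) ->
            \bigcap_i C i !=set0].

(* The least t with the property above; None stands for infinity. *)
Definition gamma (R : realType) (s r d : nat) : option nat :=
  if pselect (exists t, `[< rainbow_intersection_property R s r d t >]) is left h
  then Some (ex_minn h) else None.

(* Main.v *)
Require Import Defs.
From mathcomp Require Import all_boot reals.
From mathcomp Require Import order ssralg ssrnum poly matrix interval_inference.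
From mathcomp Require Import finmap boolp classical_sets convex zify ring lra.

(** All classes are placed on the moment curve x |-> (x, x^2, ..., x^d). The
values at the points of the curve of an affine function on R^d are the values
at their parameters of a polynomial of degree at most d, and conversely, so
two finite subsets of the curve have disjoint convex hulls as soon as some
such polynomial is negative on one set of parameters and nonnegative on the
other ([hull_arc_sep]). There are two ways to get one:
- interpolation, if there are at most d + 1 parameters in total
  ([hull_arc_general_position]);
- a polynomial of degree one, if one set of parameters lies entirely below
  the other ([hull_arc_lt]).

Let X and Z be disjoint sets of at most d + 1 points of the curve each, for
instance two disjoint rainbow sets. Put m = ceil((d + 1) / 2). Sort both
by parameter and cut X into its first m points A and the rest B, and Z into
its first d + 1 - m points E and the rest F. Among the four hull pairs, (A, E),
(B, E) and (B, F) involve at most d + 1 points each. The pair (A, F) may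
involve d + 2, but there A lies below F, possibly after exchanging the roles
of X and Z. Hence the 2-convex sets hull A `|` hull B and hull E `|` hull F,
which contain X and Z, are disjoint ([separate_moment]), no matter how large
the classes are. Taking these two sets as covers of two of the rainbow sets,
and the whole space as cover of the others, gives an empty intersection. *)

Set Implicit Arguments.
Unset Strict Implicit.
Unset Printing Implicit Defensive.

Import Order.TTheory GRing.Theory Num.Theory.
Local Open Scope classical_set_scope.
Local Open Scope ring_scope.

(** Newton's scheme: a multiple of the product of the X - x over the nodes
already treated corrects the value at a new node without disturbing the
others. *)
Lemma interpolation (F : fieldType) (f : F -> F) (s : seq F) : uniq s ->
  exists2 p : {poly F}, (size p <= size s)%N & {in s, forall x, p.[x] = f x}.
Proof.
elim: s => [_|a s IHs /= /andP[as' us]].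
  by exists 0; rewrite ?size_poly0.
have [p sp ps] := IHs us.
pose q := \prod_(x <- s) ('X - x%:P).
have qa : q.[a] != 0 by have := as'; rewrite -root_prod_XsubC rootE.
exists (p + ((f a - p.[a]) / q.[a]) *: q).
  rewrite (leq_trans (size_polyD _ _))// geq_max (leq_trans sp)//=.
  by rewrite (leq_trans (size_scale_leq _ _))// size_prod_XsubC.
move=> x; rewrite inE hornerD hornerZ => /predU1P[->|xs].
  by rewrite divfK// addrC subrK.
have /eqP-> : q.[x] == 0 by rewrite -rootE root_prod_XsubC.
by rewrite mulr0 addr0 ps.
Qed.

(** * Convex hulls of subsets of the moment curve *)

Section Hull.
Variables (R : realType) (d : nat).
Implicit Types (A : set 'rV[R]_d) (s u : seq R) (p : {poly R}).

Definition hull A : set 'rV[R]_d :=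
  [set v | forall K : set 'rV[R]_d, convex_set K -> A `<=` K -> K v].

Lemma convex_hull A : convex_set (hull A).
Proof.
move=> x y l; rewrite !inE => xA yA K cK AK.
by have := cK x y l; rewrite !inE; apply; [apply: xA|apply: yA].
Qed.

Lemma sub_hull A : A `<=` hull A.
Proof. by move=> v Av K _; apply. Qed.

Lemma s_convexW n m (A : set 'rV[R]_d) :
  (n <= m)%N -> s_convex n A -> s_convex m A.
Proof.
by move=> nm [k [K [kn cK ->]]]; exists k, K; split; rewrite ?(leq_trans kn).
Qed.

Lemma s_convexT n : (0 < n)%N -> s_convex n [set: 'rV[R]_d].
Proof.
exists 1%N, (fun=> setT); split=> // [_ x y l _ _|]; first by rewrite in_setT.
by apply/seteqP; split=> // v _; exists ord0.
Qed.

Lemma s_convexU_hull A B : s_convex 2 (hull A `|` hull B).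
Proof.
exists 2%N, (fun k : 'I_2 => hull (if k == ord0 then A else B)); split=> //.
  by move=> k; apply: convex_hull.
apply/seteqP; split=> [v [vA|vB]|v [k _]]; last by case: ifP; [left|right].
  by exists ord0.
by exists ord_max.
Qed.

Definition moment (x : R) : 'rV[R]_d := \row_i x ^+ i.+1.

(** The affine function on R^d that restricts to the polynomial p on the
moment curve. *)
Definition poly_affine p (v : 'rV[R]_d) : R :=
  p`_0 + \sum_(i < d) p`_i.+1 * v ord0 i.

Lemma poly_affine_moment p x : (size p <= d.+1)%N ->
  poly_affine p (moment x) = p.[x].
Proof.
move=> /horner_coef_wide->; rewrite big_ord_recl expr0 mulr1.
by congr (_ + _); apply: eq_bigr => i _; rewrite mxE.
Qed.

Lemma poly_affine_conv p (a : {i01 R}) (x y : convex_lmodType 'rV[R]_d) :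
  poly_affine p (conv a x y) =
  a%:num * poly_affine p x + (1 - a%:num) * poly_affine p y.
Proof.
rewrite /poly_affine !mulrDr !mulr_sumr addrACA -big_split/=.
congr (_ + _); first by ring.
by apply: eq_bigr => i _; rewrite !mxE /unstable.onem; ring.
Qed.

Lemma convex_poly_affine_lt0 p : convex_set [set v | poly_affine p v < 0].
Proof.
move=> x y a; rewrite !inE /= poly_affine_conv => x0 y0.
have : 0 <= a%:num by []. have : a%:num <= 1 by []. nra.
Qed.

Lemma convex_poly_affine_ge0 p : convex_set [set v | 0 <= poly_affine p v].
Proof.
move=> x y a; rewrite !inE /= poly_affine_conv => x0 y0.
have : 0 <= a%:num by []. have : a%:num <= 1 by []. nra.
Qed.

Definition arc s : set 'rV[R]_d := [set moment x | x in [set` s]].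

(** The half-spaces poly_affine p < 0 and poly_affine p >= 0 are disjoint and
convex, so each hull stays in its own. *)
Lemma hull_arc_sep p s u : (size p <= d.+1)%N ->
    {in s, forall x, p.[x] < 0} -> {in u, forall x, 0 <= p.[x]} ->
  hull (arc s) `&` hull (arc u) = set0.
Proof.
move=> pd ps pu; apply/seteqP; split=> // v [vs vu].
have := vs _ (@convex_poly_affine_lt0 p).
have := vu _ (@convex_poly_affine_ge0 p).
rewrite /= => v0 v1.
have : poly_affine p v < 0.
  by apply: v1 => _ [x /= xs <-]; rewrite poly_affine_moment// ps.
rewrite ltNge => /negP; apply; apply: v0 => _ [x /= xs <-].
by rewrite poly_affine_moment// pu.
Qed.

(** At most d + 1 points of the moment curve are affinely independent; here
this appears as the freedom to prescribe the value -1 on s and 0 on u. *)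
Lemma hull_arc_general_position s u :
    uniq (s ++ u) -> (size s + size u <= d.+1)%N ->
  hull (arc s) `&` hull (arc u) = set0.
Proof.
move=> us sd.
have [p sp pE] := interpolation (fun x => if x \in s then -1 else 0) us.
apply: (hull_arc_sep (p := p)) => [|x xs|x xu].
- by rewrite (leq_trans sp)// size_cat.
- by rewrite pE ?mem_cat xs// oppr_lt0.
- rewrite pE ?mem_cat ?xu ?orbT//; case: ifP => // xs.
  move: us; rewrite cat_uniq => /and3P[_ /hasPn/(_ x xu)]; by rewrite /= xs.
Qed.

(** The hyperplane orthogonal to the first axis through the least point of u
separates. *)
Lemma hull_arc_lt s u : (0 < d)%N -> sorted <%R u ->
    {in s & u, forall x y, x < y} ->
  hull (arc s) `&` hull (arc u) = set0.
Proof.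
move=> d0; case: u => [_ _|c u uc su].
  (* With u empty there is no threshold to take; a negative constant serves. *)
  apply: (hull_arc_sep (p := (-1)%:P)) => // [|x _].
    by rewrite (leq_trans (size_polyC_leq1 _)).
  by rewrite hornerC oppr_lt0.
apply: (hull_arc_sep (p := 'X - c%:P)) => [|x xs|x xu].
- by rewrite size_XsubC.
- by rewrite hornerXsubC subr_lt0 su ?mem_head.
- rewrite hornerXsubC subr_ge0; move: xu; rewrite inE => /predU1P[->//|xu].
  by rewrite ltW// (allP (order_path_min lt_trans uc)).
Qed.

(** The two pieces may share one element, when k = m + 1; this is why only a
weak inequality holds, and it occurs below when d + 1 is odd. *)
Lemma take_drop_le k m s x y : sorted <%R s -> (k <= m.+1)%N ->
  x \in take k s -> y \in drop m s -> x <= y.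
Proof.
move=> ss km /(nthP 0)[i + <-] /(nthP 0)[j + <-].
rewrite size_drop size_take_min ltn_min => /andP[ik is'] js.
rewrite nth_take// nth_drop lt_sorted_leq_nth// ?inE -?ltn_subRL//.
rewrite -ltnS -addSn; exact: leq_trans (leq_trans ik km) (leq_addr _ _).
Qed.

(** The halving argument. The cut positions are m and d + 1 - m rather than m
in both sequences so that the only pair of pieces that can involve more than
d + 1 points is a lower piece against an upper piece, which the order on the
line can separate. *)
Lemma separate_moment_sorted s u : (0 < d)%N ->
    sorted <%R s -> sorted <%R u -> uniq (s ++ u) ->
    (size s <= d.+1)%N -> (size u <= d.+1)%N ->
  exists C D : set 'rV[R]_d,
    [/\ s_convex 2 C, s_convex 2 D, arc s `<=` C, arc u `<=` D
      & C `&` D = set0].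
Proof.
move=> d0; pose m := uphalf d.+1.
have [lem gem] : (d.+1 <= m + m /\ m + m <= d.+2)%N.
  by rewrite /m uphalf_half; have := odd_double_half d.+1; lia.
wlog lt_su : s u / {in take m s & drop (d.+1 - m) u, forall x y, x < y}.
  move=> sep ss su us sd ud.
  have [/sep|] := pselect {in take m s & drop (d.+1 - m) u, forall x y, x < y}.
    exact.
  move=> nlt; have [||||||C [D [sC sD sub_C sub_D CD]]] := sep u s => //.
  (* A single pair y <= x violating the exchanged property forces the original
     one: a <= y <= x <= b, and a != b because s and u are disjoint. *)
  - move=> x y xu ys; rewrite ltNge; apply/negP => yx; apply: nlt => a b a_s bu.
    rewrite lt_neqAle; apply/andP; split; last first.
      have mm : (m <= (d.+1 - m).+1)%N by lia.
      rewrite (le_trans (take_drop_le ss mm a_s ys))//.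
      exact: le_trans yx (take_drop_le su mm xu bu).
    apply: contraTneq us => ab; rewrite cat_uniq negb_and negb_and negbK.
    rewrite (introT hasP) ?orbT//; exists b; first exact: mem_drop bu.
    by rewrite /= -ab (mem_take a_s).
  - by rewrite uniq_catC.
  - by exists D, C; split; rewrite // setIC.
move=> ss su us sd ud.
pose A := take m s; pose B := drop m s.
pose E := take (d.+1 - m) u; pose F := drop (d.+1 - m) u.
have sAB : arc s `<=` hull (arc A) `|` hull (arc B).
  move=> _ [x /= xs <-]; move: xs; rewrite -(cat_take_drop m s) mem_cat.
  by case/orP => xs; [left|right]; apply: sub_hull; exists x.
have sEF : arc u `<=` hull (arc E) `|` hull (arc F).
  move=> _ [x /= xu <-]; move: xu; rewrite -(cat_take_drop (d.+1 - m) u) mem_cat.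
  by case/orP => xu; [left|right]; apply: sub_hull; exists x.
exists (hull (arc A) `|` hull (arc B)), (hull (arc E) `|` hull (arc F)).
have gp X Y : subseq X s -> subseq Y u -> (size X + size Y <= d.+1)%N ->
    hull (arc X) `&` hull (arc Y) = set0.
  move=> Xs Yu XY; apply: hull_arc_general_position => //.
  exact: subseq_uniq (cat_subseq Xs Yu) us.
split; [exact: s_convexU_hull|exact: s_convexU_hull|exact: sAB|exact: sEF|].
have AE : hull (arc A) `&` hull (arc E) = set0.
  by apply: gp; rewrite ?take_subseq// !size_take_min; lia.
have AF : hull (arc A) `&` hull (arc F) = set0.
  by apply: hull_arc_lt => //; apply: drop_sorted.
have BE : hull (arc B) `&` hull (arc E) = set0.
  apply: gp; [exact: drop_subseq|exact: take_subseq|].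
  rewrite size_take_min size_drop.
  by rewrite (leq_trans (leq_add (leq_sub2r m sd) (geq_minl _ _)))//; lia.
have BF : hull (arc B) `&` hull (arc F) = set0.
  apply: gp; rewrite ?drop_subseq// !size_drop.
  by rewrite (leq_trans (leq_add (leq_sub2r m sd) (leq_sub2r _ ud)))//; lia.
by rewrite setIUl !setIUr AE AF BE BF !setU0.
Qed.

End Hull.

(** * Two rainbow sets on the moment curve *)

Lemma moment_inj (R : realType) d : injective (@moment R d.+1).
Proof. by move=> x y /rowP/(_ ord0); rewrite !mxE. Qed.

Lemma separate_moment (R : realType) d (X Z : {fset 'rV[R]_d.+1}) :
    [set` X] `<=` range (@moment R d.+1) ->
    [set` Z] `<=` range (@moment R d.+1) ->
    [disjoint X & Z]%fset -> (#|` X| <= d.+2)%N -> (#|` Z| <= d.+2)%N ->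
  exists C D : set 'rV[R]_d.+1,
    [/\ s_convex 2 C, s_convex 2 D, [set` X] `<=` C, [set` Z] `<=` D
      & C `&` D = set0].
Proof.
(* The first coordinate of a point of the moment curve is its parameter. *)
pose params (W : {fset 'rV[R]_d.+1}) :=
  sort <=%R [seq v ord0 ord0 | v : 'rV[R]_d.+1 <- W].
pose on_curve (W : {fset 'rV[R]_d.+1}) := [set` W] `<=` range (@moment R d.+1).
have mem_params W x : on_curve W -> (x \in params W) = (moment d.+1 x \in W).
  move=> cW; rewrite mem_sort; apply/mapP/idP => [[v vW ->]|xW].
    by have [y _ yv] := cW v vW; rewrite -yv mxE expr1 yv.
  by exists (moment d.+1 x); rewrite // mxE expr1.
have uniq_params W : on_curve W -> uniq (params W).
  move=> cW; rewrite sort_uniq map_inj_in_uniq ?fset_uniq// => v w vW wW.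
  have [x _ <-] := cW v vW; have [y _ <-] := cW w wW.
  by rewrite !mxE !expr1 => ->.
have arc_params W : on_curve W -> [set` W] `<=` arc (params W).
  move=> cW v vW; have [x _ xv] := cW v vW.
  by exists x; rewrite //= mem_params// xv.
move=> cX cZ /fdisjointP XZ nX nZ.
have sorted_params W : on_curve W -> sorted <%R (params W).
  by move=> cW; rewrite lt_sorted_uniq_le uniq_params// sort_le_sorted.
have := separate_moment_sorted (ltn0Sn d)
  (sorted_params _ cX) (sorted_params _ cZ).
case=> [|||C [D [sC sD XC ZD CD]]].
- rewrite cat_uniq !uniq_params// andbT/=; apply/hasPn => x.
  by rewrite /= !mem_params//; apply: contraTN => /XZ.
- by rewrite size_sort size_map.
- by rewrite size_sort size_map.
- exists C, D; split=> //.
    exact: subset_trans (arc_params _ cX) XC.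
  exact: subset_trans (arc_params _ cZ) ZD.
Qed.

Lemma rainbow_card (T : choiceType) n (Y : 'I_n -> {fset T}) (A : {fset T}) :
  rainbow Y A -> (#|` A| <= n)%N.
Proof.
move=> [AY YA]; have -> : A = (\big[fsetU/fset0]_(j < n) (A `&` Y j))%fset.
  apply/fsetP => x; apply/idP/bigfcupP => [xA|[j _]]; last by rewrite inE => /andP[].
  by have [j _ /= xj] := AY x xA; exists j; rewrite ?mem_index_enum// inE xA.
rewrite -[leqRHS]card_ord -sum1_card.
apply: (big_ind2 (fun (B : {fset T}) k => #|` B| <= k)%N).
- by rewrite cardfs0.
- move=> B b C c Bb Cc; exact: leq_trans (leq_card_fsetU B C) (leq_add Bb Cc).
- by move=> j _; rewrite YA.
Qed.

Local Close Scope ring_scope.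

Theorem theorem1p5 (R : realType) (r d s : nat)
  (hr : 2 <= r) (hd : 1 <= d) (hs : 2 <= s) :
  gamma R s r d = None.
Proof.
rewrite /gamma; case: pselect => // h; exfalso.
case: h => t /asboolP; case: d hd => // d _.
(* The class of index j consists of the points of the curve with parameters
   j * t, ..., j * t + t - 1. *)
pose pt (j : 'I_d.+2) (i : nat) : 'rV[R]_d.+1 := moment d.+1 (j * t + i)%:R.
pose Y j : {fset 'rV[R]_d.+1} := [fset x in [seq pt j i | i <- iota 0 t]]%fset.
have pt_inj j j' i i' : i < t -> i' < t -> pt j i = pt j' i' -> j = j' /\ i = i'.
  move=> it i't /moment_inj/eqP; rewrite eqr_nat => /eqP e.
  have ii' : i = i' by have := congr1 (modn^~ t) e; rewrite !modnMDl !modn_small.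
  split=> //; apply: val_inj; move/eqP: e; rewrite ii' eqn_add2r eqn_pmul2r.
    by move/eqP.
  exact: leq_ltn_trans i't.
have disjY : pairwise_disjoint Y.
  move=> j j' jj'; apply/fdisjointP => v; rewrite !inE.
  case/mapP => i; rewrite mem_iota => it ->; apply: contraNN jj' => /mapP[i'].
  by rewrite mem_iota => i't /pt_inj[] // ->.
have cardY j : t <= #|` Y j|.
  rewrite card_fseq undup_id ?size_map ?size_iota// map_inj_in_uniq ?iota_uniq//.
  by move=> i i'; rewrite !mem_iota => it i't /pt_inj[].
have curveY j : [set` Y j] `<=` range (@moment R d.+1).
  by move=> v /=; rewrite inE => /mapP[i _ ->]; exists (j * t + i)%:R%R.
move=> /(_ Y disjY cardY)[P [disjP rP /=]].
have curveP i : [set` P i] `<=` range (@moment R d.+1).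
  by move=> v /(rP i).1[j _]; apply: curveY.
pose i0 : 'I_r := Ordinal (ltnW hr); pose i1 : 'I_r := Ordinal hr.
have [C [D [sC sD PC PD CD]]] := separate_moment (curveP i0) (curveP i1)
  (disjP i0 i1 isT) (rainbow_card (rP i0)) (rainbow_card (rP i1)).
pose K (i : 'I_r) := if i == i0 then C else if i == i1 then D else setT.
move=> /(_ K) [i|i|v vK].
- rewrite /K; case: ifP => _; first exact: s_convexW sC.
  by case: ifP => _; [exact: s_convexW sD|exact/s_convexT/ltnW].
- by rewrite /K; case: ifP => [/eqP->//|_]; case: ifP => [/eqP->//|_].
- have : (C `&` D) v.
    by split; [have := vK i0 Logic.I|have := vK i1 Logic.I]; rewrite /K ?eqxx.
  by rewrite CD.
Qed.
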